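(* Let $a\in\mathbb{N}$, $b\in\mathbb{Z}$ and $g:=(a,b)$, $a':=a/g$, $b':=b/g$. Assume that $\tau_{a'}(\mathrm{rad}(g))$ has the prime factorization $\tau_{a'}(\mathrm{rad}(g))=q_1\cdots q_s$ (so $q_1,\dots,q_s$ are the distinct primes dividing $g$ but not $a'$; $s=0$ is possible). Then the following statements are equivalent. \begin{enumerate} \item[(1)] $\rho(a,b)=\infty$. \item[(2)] There is an $n\in\mathbb{N}_{>-b/a}$ such that $\mathrm{rad}(a'n+b')\mid g$ and $a'n+b'\geq 2$. \item[(3)] There are $\alpha_1,\dots,\alpha_s\in\mathbb{N}_0$ such that $\alpha_1+\cdots+\alpha_s>0$ and $q_1^{\alpha_1}\cdots q_s^{\alpha_s}\equiv b' \bmod a'$. \item[(4)] $\mathrm{rad}(g)\nmid a'$ and there are $\alpha_1,\dots,\alpha_s\in\mathbb{N}_0$ such that $q_1^{\alpha_1}\cdots q_s^{\alpha_s}\equiv b'\bmod a'$. \end{enumerate}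
   Context: $\mathbb{N}$ is the set of positive integers, $\mathbb{N}_0=\mathbb{N}\cup\{0\}$, $\mathbb{N}_{>y}:=\{n\in\mathbb{N}: n>y\}$ for real $y$, $(a,b)=\gcd(a,b)$, and $\mathrm{rad}(n)=\prod_{p\mid n}p$ (product over primes) for a nonzero integer $n$. For a prime $p$ and $k\in\mathbb{N}$, $p^k\,\|\,m$ means $p^k\mid m$ and $p^{k+1}\nmid m$; for integers $m\ne0$ and $n$, $\tau_n(m):=\prod_{p^k\| m,\ p\nmid n}p^k$. For $a\in\mathbb{N}$, $b\in\mathbb{Z}$, with $g=(a,b)$, $a'=a/g$, $b'=b/g$, define \[R(a,b):=\{n\in\mathbb{N}_{>-b/a}:\ \mathrm{rad}(a'n+b')\mid g\},\qquad \rho(a,b):=\#R(a,b),\] where $\rho(a,b)$ may be $\infty$. *)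

(* Defs.v *)
From mathcomp Require Import all_boot all_order all_algebra.
From mathcomp Require Import finmap.
From mathcomp Require Import boolp classical_sets cardinality constructive_ereal.

Set Implicit Arguments.
Unset Strict Implicit.
Unset Printing Implicit Defensive.

Import Order.TTheory GRing.Theory Num.Theory.

Local Open Scope classical_set_scope.
Local Open Scope ring_scope.

(* The zero integer, on which the radical is not defined, gets the value 1. *)
Definition radz (n : int) : nat := (\prod_(p <- primes `|n|) p)%N.

(* For a prime p dividing m <> 0, the k with p^k || m is logn p `|m|. *)
Definition tau (n m : int) : nat :=
  (\prod_(p <- primes `|m| | ~~ (p%:Z %| n)%Z) p ^ logn p `|m|)%N.

Definition N_gt (y : rat) : set nat := [set n | (0 < n)%N /\ y < n%:R].

Definition Rset (a : nat) (b : int) : set nat :=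
  let g : int := gcdz a b in
  let a' : int := (a %/ g)%Z in
  let b' : int := (b %/ g)%Z in
  [set n | N_gt (- (b%:~R / a%:R)) n /\ ((radz (a' * n%:Z + b'))%:Z %| g)%Z].

Definition rho (a : nat) (b : int) : \bar nat :=
  if `[< finite_set (Rset a b) >] then EFin #|` fset_set (Rset a b)|%fset
  else +oo%E.

(* Main.v *)
Require Import Defs.
From mathcomp Require Import all_boot all_order all_algebra.
From mathcomp Require Import cyclic zify.
From mathcomp Require Import finmap boolp classical_sets cardinality constructive_ereal.

Set Implicit Arguments.
Unset Strict Implicit.
Unset Printing Implicit Defensive.

Import Order.TTheory GRing.Theory Num.Theory.
Local Open Scope ring_scope.

(** Write [g], [a'], [b'] for the gcd of [a] and [b] and the two cofactors;
    [a'] and [b'] are coprime.  Since [a = g a'] and [b = g b'], the inequality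
    [n > -b/a] says exactly that the value [m = a' n + b'] is positive
    ([N_gt_affine]), so that [R(a, b)] is the set of the positive [n] whose
    value is positive and has all its prime factors among those of [g]
    ([Rset_affine]).  Everything is then about the positive integers
    congruent to [b'] mod [a'] all of whose primes divide [g].

    A prime dividing both such an [m] and [a'] would divide [b'], against
    coprimality.  Hence the primes of [m] divide [g] and not [a'], which is to
    say that they are among the [q i] ([tau_radz_primes]), and [m] is a product
    of powers of the [q i], with a nonzero exponent as soon as [m >= 2]: this
    is (2) => (3) ([affine_value_factorization]).  A nonzero exponent requires
    that some [q i] exists, and this [q i] is a prime of [g] that does not
    divide [a']: this is (3) => (4).

    Conversely, if [rad g] does not divide [a'], some [q j] exists.  It is
    invertible mod [a'], so by Euler's theorem multiplying a product of powers
    of the [q i] by powers of [q j] with exponent a multiple of [totient a']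
    preserves its class mod [a'].  This yields arbitrarily large solutions:
    (4) => (1) ([unbounded_affine_values]).  Finally (1) => (2) holds because
    values at large [n] are large. *)

(** Distinct primes are pairwise coprime. *)
Lemma prod_uniq_primes_dvd (s : seq nat) (d : nat) :
  uniq s -> all prime s -> (\prod_(p <- s) p %| d)%N = all (dvdn^~ d) s.
Proof.
elim: s => [|p s IHs] /=; first by rewrite big_nil dvd1n.
move=> /andP[ps us] /andP[p_pr s_pr]; rewrite big_cons Gauss_dvd ?IHs //.
rewrite prime_coprime // Euclid_dvd_prod // big_has; apply/hasPn=> r rs.
have r_pr := allP s_pr r rs.
by rewrite dvdn_prime2 //; apply: contraNneq ps => ->.
Qed.

(** Valid for [m = 0] as well, both sides being true then. *)
Lemma radz_dvd (m : int) (d : nat) :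
  (radz m %| d)%N = all (dvdn^~ d) (primes `|m|).
Proof. by rewrite prod_uniq_primes_dvd ?primes_uniq ?all_prime_primes. Qed.

Lemma radz_gt0 (m : int) : (0 < radz m)%N.
Proof.
rewrite /radz big_seq_cond prodn_cond_gt0 // => p /andP[].
by rewrite mem_primes => /andP[/prime_gt0].
Qed.

Lemma prime_dvd_radz (p : nat) (m : int) :
  prime p -> m != 0 -> (p %| radz m)%N = (p %| `|m|)%N.
Proof.
move=> p_pr m_neq0; rewrite Euclid_dvd_prod // big_has.
apply/hasP/idP=> [[r] | pm].
  rewrite mem_primes => /and3P[r_pr _ rm].
  by rewrite dvdn_prime2 // => /eqP->.
by exists p; rewrite // mem_primes p_pr pm absz_gt0 m_neq0.
Qed.

Lemma prime_dvd_tau (p : nat) (n m : int) : prime p -> m != 0 ->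
  (p %| tau n m)%N = (p %| `|m|)%N && ~~ (p%:Z %| n)%Z.
Proof.
move=> p_pr m_neq0; rewrite Euclid_dvd_prod // big_has_cond.
apply/hasP/andP=> [[r] | [pm pn]].
  rewrite mem_primes => /and3P[r_pr _ rm] /andP[rn].
  by rewrite Euclid_dvdX // dvdn_prime2 // => /andP[/eqP-> _].
exists p; first by rewrite mem_primes p_pr pm absz_gt0 m_neq0.
apply/andP; split; first exact: pn.
by rewrite Euclid_dvdX // dvdnn logn_gt0 mem_primes p_pr pm absz_gt0 m_neq0.
Qed.

(** By strong induction on [m], one prime factor being divided out at each
    step.  Repetitions among the [q i] are harmless, since each step only
    selects one index carrying the removed prime; this avoids deriving the
    injectivity of [q] from the squarefreeness of [rad g]. *)
Lemma prod_expn_of_prime_divisors (s : nat) (q : 'I_s -> nat) (m : nat) :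
  (0 < m)%N ->
  (forall p, prime p -> (p %| m)%N -> exists i, p = q i) ->
  exists alpha : 'I_s -> nat, m = (\prod_(i < s) q i ^ alpha i)%N.
Proof.
elim/ltn_ind: m => m IHm m_gt0 qm.
case: (ltngtP m 1) => [|m_gt1|->]; first by rewrite ltnNge m_gt0.
  have [j qj] := qm _ (pdiv_prime m_gt1) (pdiv_dvd m).
  have q_gt1 : (1 < q j)%N by rewrite -qj prime_gt1 // pdiv_prime.
  have def_m : (q j * (m %/ q j) = m)%N by rewrite mulnC divnK // -qj pdiv_dvd.
  have mq_gt0 : (0 < m %/ q j)%N.
    by rewrite -(ltn_pmul2l (ltnW q_gt1)) muln0 def_m.
  case: (IHm (m %/ q j)%N) => // [|p p_pr pm|alpha def_mq].
  - by rewrite ltn_Pdiv.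
  - by apply: qm => //; rewrite -def_m dvdn_mull.
  exists (fun i => (i == j) + alpha i)%N.
  under eq_bigr do rewrite expnD; rewrite big_split /= -def_mq -{1}def_m.
  by congr (_ * _)%N; rewrite (bigD1 j) //= eqxx big1 ?muln1 // => i /negPf->.
by exists (fun=> 0%N); rewrite big1.
Qed.

Lemma infinite_set_natP (A : set nat) :
  ~ finite_set A <-> forall N, exists2 n, (N <= n)%N & A n.
Proof.
split=> [Ainf N | Aunb /finite_seqP[s defA]].
  apply: contrapT => noN; apply: Ainf; apply: sub_finite_set (finite_II N).
  move=> n An /=; rewrite ltnNge; apply/negP=> Nn.
  by apply: noN; exists n.
have [n leSn An] := Aunb (\max_(i <- s) i).+1.
have ns : n \in s by have := An; rewrite defA.
by have := @leq_bigmax_seq _ s xpredT id n ns isT; rewrite leqNgt leSn.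
Qed.

(** The form in which the infinitude of [R(a, b)] is used: (1) => (2) needs one
    large element, (4) => (1) produces elements beyond any bound. *)
Lemma rho_infty (a : nat) (b : int) :
  rho a b = +oo%E <-> forall N, exists2 n, (N <= n)%N & Rset a b n.
Proof.
by rewrite -infinite_set_natP /rho; case: asboolP.
Qed.

Lemma expn_totient_mul (q m k : nat) :
  coprime q m -> (q ^ (totient m * k) = 1 %[mod m])%N.
Proof.
by move=> qm; rewrite expnM -modnXm Euler_exp_totient // modnXm exp1n.
Qed.

(** The gcd and the cofactor of [a] are nonnegative integers; presenting them as
    natural numbers lets the coprimality, totient and divisibility results on
    [nat] apply. *)
Lemma gcdz_cofactors (a : nat) (b : int) : (0 < a)%N ->
  let g := gcdn a `|b| in
  exists2 A : nat, (a %/ gcdz a b)%Z = A%:Z &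
  [/\ (0 < g)%N, (0 < A)%N, a = (g * A)%N, b = g%:Z * (b %/ gcdz a b)%Z
    & coprime A `|(b %/ gcdz a b)%Z|].
Proof.
move=> a_gt0 g; have g_gt0 : (0 < g)%N by rewrite gcdn_gt0 a_gt0.
have ga : (g %| a)%N by rewrite dvdn_gcdl.
have gb : (g%:Z %| b)%Z by rewrite dvdzE dvdn_gcdr.
have gE : gcdz a b = g%:Z by [].
exists (a %/ g)%N; first by rewrite gE divz_nat.
have defa : a = (g * (a %/ g))%N by rewrite mulnC divnK.
have defb : b = g%:Z * (b %/ g)%Z by rewrite mulrC divzK.
split=> //; first by rewrite divn_gt0 // dvdn_leq.
have gbE : (g * `|(b %/ g)%Z|)%N = `|b|%N by rewrite [in RHS]defb abszM.
by rewrite /coprime gE -(eqn_pmul2l g_gt0) muln_gcdr -defa gbE muln1.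
Qed.

(** Clearing the denominator [g * A] in [- (g c) / (g A) < n] and cancelling
    [g]. *)
Lemma N_gt_affine (g A : nat) (c : int) (n : nat) : (0 < g)%N -> (0 < A)%N ->
  N_gt (- ((g%:Z * c)%:~R / (g * A)%N%:R)) n <->
  (0 < n)%N /\ 0 < A%:Z * n%:Z + c.
Proof.
move=> g_gt0 A_gt0; suff -> : (0 < A%:Z * n%:Z + c) =
    (- ((g%:Z * c)%:~R / (g * A)%N%:R) < n%:R :> rat) by [].
have gR : (0 : rat) < g%:R by rewrite ltr0n.
have AR : (0 : rat) < A%:R by rewrite ltr0n.
rewrite -mulNr ltr_pdivrMr ?ltr0n ?muln_gt0 ?g_gt0 //.
rewrite natrM intrM -mulrN mulrCA ltr_pM2l // -subr_gt0 opprK mulrC.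
by rewrite -(ltr0z rat) intrD intrM.
Qed.


(** Membership in [R(a, b)] concerns only the value [a' n + b'] and the primes
    of the gcd; no rational number is left. *)
Lemma Rset_affine (a : nat) (b : int) (n : nat) : (0 < a)%N ->
  let m := (a %/ gcdz a b)%Z * n%:Z + (b %/ gcdz a b)%Z in
  Rset a b n <-> [/\ (0 < n)%N, 0 < m & (radz m %| gcdn a `|b|)%N].
Proof.
move=> a_gt0 m.
have [A defA [g_gt0 A_gt0 defa defb _]] := gcdz_cofactors b a_gt0.
have N_gtE := @N_gt_affine _ A (b %/ gcdz a b)%Z n g_gt0 A_gt0.
rewrite -defa -defb -defA in N_gtE.
split; first by move=> [/N_gtE[n_gt0 m_gt0] rad_m].
by move=> [n_gt0 m_gt0 rad_m]; split=> //; apply/N_gtE.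
Qed.

(** All that the argument uses of the factorization of [tau n (rad g)]: it
    identifies the set of the [q i]. *)
Lemma tau_radz_primes (n : int) (g : nat) (s : nat) (q : 'I_s -> nat) :
  (0 < g)%N -> (forall i, prime (q i)) ->
  tau n (radz g) = (\prod_(i < s) q i)%N ->
  forall p, prime p ->
  (p %| g)%N && ~~ (p%:Z %| n)%Z <-> exists i, p = q i.
Proof.
move=> g_gt0 q_pr tauE p p_pr.
have g_neq0 : g%:Z != 0 by rewrite eqz_nat -lt0n.
have rad_neq0 : (radz g)%:Z != 0 by rewrite eqz_nat -lt0n radz_gt0.
rewrite -[(p %| g)%N](prime_dvd_radz p_pr g_neq0).
rewrite -(prime_dvd_tau _ p_pr rad_neq0).
rewrite tauE Euclid_dvd_prod // big_has; split=> [/hasP[i _]|[i ->]].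
  by rewrite dvdn_prime2 // => /eqP->; exists i.
by apply/hasP; exists i; rewrite ?mem_index_enum.
Qed.

(** A common prime factor of [m] and [A] would divide [c], so that the primes of
    [m], which divide [g], do not divide [A]. *)
Lemma affine_value_factorization
    (A g s : nat) (q : 'I_s -> nat) (c m : int) :
  coprime A `|c| ->
  (forall p, prime p -> (p %| g)%N && ~~ (p%:Z %| A%:Z)%Z ->
     exists i, p = q i) ->
  2 <= m -> (radz m %| g)%N -> (m = c %[mod A])%Z ->
  exists alpha : 'I_s -> nat,
    (0 < \sum_(i < s) alpha i)%N /\
    ((\prod_(i < s) q i ^ alpha i)%N%:Z = c %[mod A])%Z.
Proof.
move=> copAc qP m_ge2; rewrite radz_dvd => /allP rad_m m_mod.
have absm : `|m|%N%:Z = m by lia.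
case: (@prod_expn_of_prime_divisors s q `|m|%N); first by lia.
  move=> p p_pr pm; apply: qP => //; rewrite rad_m; last first.
    by rewrite mem_primes p_pr pm; lia.
  apply/negP=> pA; have pc : (p%:Z %| c)%Z.
    have /eqP := m_mod; rewrite eqz_mod_dvd => /(dvdz_trans pA).
    by move=> p_mc; rewrite -[c](subKr m) rpredB.
  have: (p %| gcdn A `|c|)%N by rewrite dvdn_gcd; apply/andP.
  by rewrite (eqP copAc) Euclid_dvd1.
move=> alpha def_m; exists alpha; rewrite -def_m absm; split=> //.
(* With all exponents zero, m would be the empty product 1. *)
rewrite lt0n; apply: contraTneq m_ge2 => /eqP.
rewrite sum_nat_eq0 => /forallP alpha0.
by rewrite -absm def_m big1 // => i _; rewrite (eqP (alpha0 i)).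
Qed.

(** The prime [q j] is invertible mod [A], so multiplying the given product by
    [q j ^ (totient A * k)] leaves its class mod [A] unchanged, by Euler's
    theorem, and makes it as large as desired without introducing any prime
    outside [g]. *)
Lemma unbounded_affine_values (A g s : nat) (q alpha : 'I_s -> nat)
    (j : 'I_s) (c : int) :
  (0 < A)%N -> (forall i, prime (q i)) -> (forall i, (q i %| g)%N) ->
  ~~ (q j %| A)%N ->
  ((\prod_(i < s) q i ^ alpha i)%N%:Z = c %[mod A])%Z ->
  forall N, exists2 n, (N <= n)%N &
    [/\ (0 < n)%N, 0 < A%:Z * n%:Z + c & (radz (A%:Z * n%:Z + c) %| g)%N].
Proof.
move=> A_gt0 q_pr qg qjA P_mod N; set P := (\prod_(i < s) _)%N in P_mod.
(* M > k gives A * n = M - c > A * (N + 1) + |c| - c, whence n > N. *)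
pose k := (`|c| + A * N.+1)%N; pose M := (P * q j ^ (totient A * k))%N.
have P_gt0 : (0 < P)%N by apply: prodn_gt0 => i; rewrite expn_gt0 prime_gt0.
have k_lt : (k < q j ^ (totient A * k))%N.
  apply: leq_trans (ltn_expl k (prime_gt1 (q_pr j))) _.
  by rewrite leq_pexp2l ?prime_gt0 // leq_pmull ?totient_gt0.
have M_gt : (k < M)%N by apply: leq_trans k_lt _; rewrite leq_pmull.
have M_mod : (A%:Z %| M%:Z - c)%Z.
  rewrite -eqz_mod_dvd; apply/eqP; rewrite -P_mod !modz_nat /M; congr (_%:Z).
  by rewrite -modnMmr expn_totient_mul ?modnMmr ?muln1 // prime_coprime.
have {M_mod} [n def_n] : exists n : nat, M%:Z - c = A%:Z * n%:Z.
  have [z def_z] := dvdzP M_mod.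
  have z_ge0 : 0 <= z by rewrite -(pmulr_lge0 _ (_ : 0 < A%:Z)) -?def_z; lia.
  by exists `|z|%N; rewrite def_z mulrC gez0_abs.
have valE : A%:Z * n%:Z + c = M%:Z by rewrite -def_n subrK.
have ltNn : (N < n)%N.
  by rewrite -(leq_pmul2l A_gt0); lia.
exists n; first exact: ltnW.
rewrite valE; split; [by lia|by lia|].
rewrite radz_dvd; apply/allP=> p; rewrite mem_primes => /and3P[p_pr _].
rewrite Euclid_dvdM // Euclid_dvdX // Euclid_dvd_prod // big_has.
have dvdq i : (p %| q i)%N -> (p %| g)%N by move=> /dvdn_trans; apply.
case/orP=> [/hasP[i _] | /andP[/dvdq]//].
by rewrite Euclid_dvdX // => /andP[/dvdq].
Qed.

Theorem theorem26 (a : nat) (b : int) (ha : (0 < a)%N) :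
  let g : int := gcdz a b in
  let a' : int := (a %/ g)%Z in
  let b' : int := (b %/ g)%Z in
  forall (s : nat) (q : 'I_s -> nat),
    (forall i : 'I_s, prime (q i)) ->
    tau a' (radz g) = (\prod_(i < s) q i)%N ->
    [<-> rho a b = +oo%E;
         exists n : nat,
           [/\ N_gt (- (b%:~R / a%:R)) n,
               ((radz (a' * n%:Z + b'))%:Z %| g)%Z
             & 2 <= a' * n%:Z + b'];
         exists alpha : 'I_s -> nat,
           (0 < \sum_(i < s) alpha i)%N /\
           ((\prod_(i < s) q i ^ alpha i)%N%:Z = b' %[mod a'])%Z;
         ~ ((radz g)%:Z %| a')%Z /\
         exists alpha : 'I_s -> nat,
           ((\prod_(i < s) q i ^ alpha i)%N%:Z = b' %[mod a'])%Z].
Proof.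
move=> g a' b' s q q_pr tauE.
have RsetE n := @Rset_affine a b n ha.
have [A a'E [g_gt0 A_gt0 _ _ copAb']] := gcdz_cofactors b ha.
rewrite -/g -/a' -/b' in RsetE a'E copAb'.
have qP := @tau_radz_primes _ _ _ _ g_gt0 q_pr tauE.
have q_dvd i : (q i %| gcdn a `|b|)%N && ~~ ((q i)%:Z %| a')%Z.
  by apply/qP => //; exists i.
rewrite a'E in RsetE qP q_dvd *.
tfae.
(* As a' >= 1, taking n >= |b'| + 2 makes a' * n + b' at least 2. *)
- move=> /rho_infty/(_ `|b'|.+2)[n n_ge Rn]; exists n.
  have [/RsetE[_ m_gt0 _] [n_gt rad_m]] := (Rn, Rn); split=> //.
    by move: rad_m; rewrite -/g -/a' -/b' a'E.
  by nia.
- move=> [n [_ rad_m m_ge2]].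
  apply: (affine_value_factorization copAb' _ m_ge2 rad_m).
    by move=> p p_pr /qP; apply.
  by rewrite mulrC modzMDl.
- move=> [alpha [alpha_gt0 P_mod]]; split; last by exists alpha.
  move=> rad_a'; have [j _ _] : exists2 j, true & alpha j != 0%N.
    move: alpha_gt0; rewrite lt0n sum_nat_eq0 negb_forall.
    by case/existsP=> j; exists j.
  have /andP[qjg /negP[]] := q_dvd j.
  apply: dvdz_trans rad_a'; rewrite dvdzE prime_dvd_radz //; first exact: q_pr.
  by rewrite -absz_gt0.
move=> [rad_a' [alpha P_mod]]; apply/rho_infty => N.
have /allPn[p] : ~~ all (dvdn^~ A) (primes `|g|).
  by rewrite -radz_dvd; apply/negP.
rewrite mem_primes => /and3P[p_pr _ pg] pA.
have [j pE] : exists j, p = q j by apply/qP => //; apply/andP.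
have qg i : (q i %| gcdn a `|b|)%N by have /andP[] := q_dvd i.
rewrite pE in pA.
have [n leNn Rn] := unbounded_affine_values A_gt0 q_pr qg pA P_mod N.
by exists n => //; apply/RsetE.
Qed.
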